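(* Let $G$ be a (finite, connected) square grid graph and fix any good labeling of $G$. Then there exists a word $w$ that $12$-represents the resulting labeled graph.
   Context: The grid graph is the infinite graph on $\mathbb{Z}^2$ with vertices adjacent iff at Euclidean distance $1$. A square of an induced subgraph $H$ of it is a set of four vertices of $H$ of the form $\{(x,y),(x+1,y),(x,y+1),(x+1,y+1)\}$. A square grid graph is a finite connected induced subgraph of the grid graph in which every vertex and edge lies in some square of it. A labeled graph has distinct positive integers as vertices. A word $w$ (over positive integers) $12$-represents a labeled graph $G=(V,E)$ if the set of letters of $w$ is $V$ and for all distinct $x,y\in V$: $xy\notin E$ iff some occurrence of $\min(x,y)$ precedes some occurrence of $\max(x,y)$ in $w$. A labeling of a graph is good if it has none of the following: (i) labels $p<q<r$ whose induced subgraph has exactly the edges $pq, qr$; (ii) labels $p<q<r<s$ whose induced subgraph has exactly the edges $pr, qs$; (iii) labels $p<q<r<s$ whose induced subgraph has exactly the edges $ps, qr$. *)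

(* Defs.v *)
From mathcomp Require Import all_boot all_order all_algebra finmap.

Set Implicit Arguments.
Unset Strict Implicit.
Unset Printing Implicit Defensive.

Import Order.TTheory GRing.Theory Num.Theory.

Local Open Scope fset_scope.
Local Open Scope ring_scope.

Definition point : Type := (int * int)%type.

(* Euclidean distance 1, expressed by its square, which is an integer. *)
Definition grid_adj (u v : point) : bool :=
  (u.1 - v.1) ^+ 2 + (u.2 - v.2) ^+ 2 == 1.

(* An induced subgraph of the grid graph is given by its vertex set. *)
Definition grid_connected (G : {fset point}) : Prop :=
  forall u v, u \in G -> v \in G ->
    exists p : seq point,
      [/\ {subset p <= G}, path grid_adj u p & last u p = v].

Definition is_square (G S : {fset point}) : Prop :=
  exists x y : int,
    S = [fset (x, y); (x + 1, y); (x, y + 1); (x + 1, y + 1)] /\ S `<=` G.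

Definition square_grid_graph (G : {fset point}) : Prop :=
  [/\ grid_connected G,
      forall u, u \in G -> exists2 S, is_square G S & u \in S
    & forall u v, u \in G -> v \in G -> grid_adj u v ->
        exists S, [/\ is_square G S, u \in S & v \in S]].

(* [lab] is only relevant on [G]. *)
Definition is_labeling (G : {fset point}) (lab : point -> nat) : Prop :=
  {in G &, injective lab} /\ {in G, forall u, (0 < lab u)%N}.

Definition label_set (G : {fset point}) (lab : point -> nat) : {fset nat} :=
  [fset lab u | u in G].

Definition label_edge (G : {fset point}) (lab : point -> nat) (a b : nat)
    : Prop :=
  exists u v, [/\ u \in G, v \in G, grid_adj u v, lab u = a & lab v = b].

Local Close Scope ring_scope.

(* In the next two definitions a labeled graph is given by its finite set [V]
   of labels and a symmetric edge relation [E] on [V]. *)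
Definition good_labeling (V : {fset nat}) (E : nat -> nat -> Prop) : Prop :=
  [/\ forall p q r, p \in V -> q \in V -> r \in V -> p < q < r ->
        ~ [/\ E p q, E q r & ~ E p r],
      forall p q r s, p \in V -> q \in V -> r \in V -> s \in V ->
        p < q < r -> r < s ->
        ~ ((E p r /\ E q s) /\ [/\ ~ E p q, ~ E p s, ~ E q r & ~ E r s])
    & forall p q r s, p \in V -> q \in V -> r \in V -> s \in V ->
        p < q < r -> r < s ->
        ~ ((E p s /\ E q r) /\ [/\ ~ E p q, ~ E p r, ~ E q s & ~ E r s])].

Definition occurs_before (w : seq nat) (a b : nat) : Prop :=
  exists i j, [/\ i < j, j < size w, nth 0 w i = a & nth 0 w j = b].

Definition represents12 (w : seq nat) (V : {fset nat})
    (E : nat -> nat -> Prop) : Prop :=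
  w =i V /\
  forall x y, x \in V -> y \in V -> x <> y ->
    (~ E x y <-> occurs_before w (minn x y) (maxn x y)).

(* Main.v *)
Require Import Defs.
From mathcomp Require Import all_boot all_order all_algebra finmap.
From mathcomp Require Import zify.

(** The grid structure plays no role: every good labeling of a finite graph is
    12-representable.  Let each letter [x] occur twice, first at [f x] and last
    at [l x].  The word represents the graph iff [f x] precedes [l y] whenever
    [x <= y] is not an edge, and [l y] precedes [f x] whenever [x < y] is an
    edge.  Eliminating the [l y] leaves a relation on the [f x], "[f x] is forced
    before [f x'] by some [y]".  The three forbidden patterns say exactly that
    this relation is asymmetric, and asymmetry already makes it transitive; so
    the number of predecessors is a rank that increases along the relation, and
    sorting the occurrences by rank gives the word. *)

Set Implicit Arguments.
Unset Strict Implicit.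
Unset Printing Implicit Defensive.

Definition lower_edge (e : rel nat) (x y : nat) : bool := (x < y) && e x y.

(** The case [x = y] is included because the first occurrence of a letter has to precede its last
    one. *)
Definition lower_nonedge (e : rel nat) (x y : nat) : bool :=
  (x <= y) && ~~ lower_edge e x y.

Definition forced_before (V : {fset nat}) (e : rel nat) (x x' : nat) : bool :=
  has (fun y => lower_nonedge e x y && lower_edge e x' y) V.

Definition first_rank (V : {fset nat}) (e : rel nat) (x : nat) : nat :=
  #|` [fset z in V | forced_before V e z x]|%fset.

(** The last occurrence of [y] is placed as early as its constraints allow. *)
Definition last_rank (V : {fset nat}) (e : rel nat) (y : nat) : nat :=
  \max_(x <- V | lower_nonedge e x y) (first_rank V e x).+1.

Lemma good_labeling_pattern3 (V : {fset nat}) (e : rel nat) (p q r : nat) :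
  good_labeling V e -> p \in V -> q \in V -> r \in V -> p < q < r ->
  e p q -> e q r -> e p r.
Proof.
case=> h _ _ pV qV rV pqr epq eqr; apply/negPn/negP => nepr.
by apply: (h p q r) => //; split => //; apply/negP.
Qed.

(** Let [x1 < x2]. Pattern (i) rules out [x2 = y2] and the edges [x1 x2] and [y1 y2]. What remains
    is pattern (iii) if [y1 < y2] and pattern (ii) if [y2 < y1]. *)
Lemma good_labeling_no_2cycle (V : {fset nat}) (e : rel nat) x1 x2 y1 y2 :
  good_labeling V e ->
  x1 \in V -> x2 \in V -> y1 \in V -> y2 \in V ->
  lower_nonedge e x1 y1 -> lower_edge e x2 y1 ->
  lower_nonedge e x2 y2 -> lower_edge e x1 y2 -> False.
Proof.
move=> hV; wlog: x1 x2 y1 y2 / x1 < x2 => [wl|].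
  case: (ltngtP x1 x2) => [lt12|lt21|eq12] x1V x2V y1V y2V n11 e21 n22 e12.
  - exact: (wl x1 x2 y1 y2).
  - exact: (wl x2 x1 y2 y1).
  - by move: n11; rewrite /lower_nonedge eq12 e21 andbF.
move=> lt12 x1V x2V y1V y2V /andP[le11 n11] /andP[lt21 e21] /andP[le22 n22]
  /andP[lt1 e12].
have t := @good_labeling_pattern3 V e _ _ _ hV.
have {}n11 : ~~ e x1 y1 by move: n11; rewrite /lower_edge (ltn_trans lt12 lt21).
have [eq22|ne22] := eqVneq x2 y2.
  by move/negP: n11; apply; apply: (t _ x2) => //; [lia|rewrite eq22].
have {}n22 : ~~ e x2 y2 by move: n22; rewrite /lower_edge ltn_neqAle ne22 le22.
have nx : ~~ e x1 x2.
  by apply/negP => exx; move/negP: n11; apply; apply: (t _ x2) => //; lia.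
case: (ltngtP y1 y2) => [lty|lty|eqy]; last by rewrite eqy e12 in n11.
  have ny : ~~ e y1 y2.
    by apply/negP => eyy; move/negP: n22; apply; apply: (t _ y1) => //; lia.
  case: hV => _ _ h; apply: (h x1 x2 y1 y2) => //; first lia.
  by split=> //; split; apply/negP.
have ny : ~~ e y2 y1.
  by apply/negP => eyy; move/negP: n11; apply; apply: (t _ y2) => //; lia.
case: hV => _ h _; apply: (h x1 x2 y2 y1) => //; first lia.
by split=> //; split; apply/negP.
Qed.

Lemma forced_before_asym (V : {fset nat}) (e : rel nat) x x' :
  good_labeling V e -> x \in V -> x' \in V ->
  forced_before V e x x' -> forced_before V e x' x -> False.
Proof.
move=> hV xV x'V /hasP[y1 y1V /andP[n1 e1]] /hasP[y2 y2V /andP[n2 e2]].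
exact: (good_labeling_no_2cycle hV xV x'V y1V y2V).
Qed.

(** One of the two given witnesses also serves for the composite: [y2] if [x <= y2], and otherwise
    [y1], since then [x'' < y2 < x <= y1]. If it failed, it would reverse one of the two given
    relations, against asymmetry. *)
Lemma forced_before_trans (V : {fset nat}) (e : rel nat) x x' x'' :
  good_labeling V e -> x \in V -> x' \in V -> x'' \in V ->
  forced_before V e x x' -> forced_before V e x' x'' -> forced_before V e x x''.
Proof.
move=> hV xV x'V x''V f1 f2.
have [y1 y1V /andP[n1 e1]] := hasP f1; have [y2 y2V /andP[n2 e2]] := hasP f2.
have [le2|lt2] := leqP x y2.
  case e3: (lower_edge e x y2).
    case: (forced_before_asym hV xV x'V f1).
    by apply/hasP; exists y2 => //; rewrite n2 e3.
  by apply/hasP; exists y2 => //; rewrite /lower_nonedge le2 e3 e2.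
have le1 : x'' <= y1 by case/andP: n1; case/andP: e2; lia.
case e3: (lower_edge e x'' y1).
  by apply/hasP; exists y1 => //; rewrite n1 e3.
case: (forced_before_asym hV x'V x''V f2).
by apply/hasP; exists y1 => //; rewrite /lower_nonedge le1 e3 e1.
Qed.

Lemma first_rank_lt (V : {fset nat}) (e : rel nat) x x' :
  good_labeling V e -> x \in V -> x' \in V ->
  forced_before V e x x' -> first_rank V e x < first_rank V e x'.
Proof.
move=> hV xV x'V f; apply/fproper_ltn_card/andP; split.
  apply/fsubsetP => z.
  by rewrite !inE /= => /andP[zV fz]; rewrite zV (forced_before_trans hV zV xV).
(* The inclusion is strict because [x] is a predecessor of [x'] but, by asymmetry, not of itself. *)
apply/fsubsetPn; exists x; rewrite !inE xV //=; apply/negP => fx.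
exact: (forced_before_asym hV xV xV fx fx).
Qed.

Lemma first_rank_lt_last_rank (V : {fset nat}) (e : rel nat) x y :
  x \in V -> lower_nonedge e x y -> first_rank V e x < last_rank V e y.
Proof. by move=> xV n; apply: (@leq_bigmax_seq _ _ _ (fun x => _.+1) x). Qed.

(** Every letter that contributes to the maximum is forced before [x] by [y] itself, so its rank is
    strictly smaller. *)
Lemma last_rank_le_first_rank (V : {fset nat}) (e : rel nat) x y :
  good_labeling V e -> x \in V -> y \in V -> lower_edge e x y ->
  last_rank V e y <= first_rank V e x.
Proof.
move=> hV xV yV exy; apply/bigmax_leqP_seq => z zV n.
by apply: first_rank_lt => //; apply/hasP; exists y => //; rewrite n exy.
Qed.

(** Odd keys for first and even keys for last occurrences turn both [first_rank < last_rank] and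
    [last_rank <= first_rank] into strict inequalities, so the order of equal keys after sorting
    does not matter. *)
Definition occurrences (V : {fset nat}) (e : rel nat) : seq (nat * nat) :=
  [seq ((first_rank V e x).*2.+1, x) | x <- V] ++
  [seq ((last_rank V e x).*2, x) | x <- V].

Lemma mem_occurrences (V : {fset nat}) (e : rel nat) k x :
  (k, x) \in occurrences V e ->
  x \in V /\ (first_rank V e x).*2 < k <= (last_rank V e x).*2.
Proof.
have r z : z \in V -> first_rank V e z < last_rank V e z.
  by move=> zV; apply: first_rank_lt_last_rank;
    rewrite // /lower_nonedge /lower_edge leqnn ltnn.
by rewrite mem_cat => /orP[] /mapP[z zV [-> ->]]; have := r z zV; split=> //; lia.
Qed.

Lemma occurs_before_key_le (s : seq (nat * nat)) a b :
  sorted (relpre fst leq) s -> occurs_before [seq p.2 | p <- s] a b ->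
  exists ka kb, [/\ (ka, a) \in s, (kb, b) \in s & ka <= kb].
Proof.
move=> ss [i [j [ij]]]; rewrite size_map => js.
have is_ := ltn_trans ij js.
rewrite !(nth_map (0, 0)) // => <- <-.
exists (nth (0, 0) s i).1, (nth (0, 0) s j).1; rewrite -!surjective_pairing.
split; rewrite ?mem_nth //.
have tr : transitive (relpre (@fst nat nat) leq).
  by move=> y x z /=; apply: leq_trans.
by apply: (sorted_leq_nth tr (fun x => leqnn x.1)) => //; apply: ltnW.
Qed.

Lemma key_lt_occurs_before (s : seq (nat * nat)) ka a kb b :
  sorted (relpre fst leq) s -> (ka, a) \in s -> (kb, b) \in s -> ka < kb ->
  occurs_before [seq p.2 | p <- s] a b.
Proof.
move=> ss as_ bs kab; exists (index (ka, a) s), (index (kb, b) s).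
rewrite size_map !(nth_map (0, 0)) ?index_mem // !nth_index //; split => //.
rewrite ltnNge; apply/negP => le.
have tr : transitive (relpre (@fst nat nat) leq).
  by move=> y x z /=; apply: leq_trans.
have := sorted_leq_nth tr (fun x => leqnn x.1) (0, 0) ss
  (index (kb, b) s) (index (ka, a) s).
by rewrite !inE !index_mem !nth_index //= => /(_ bs as_ le); rewrite leqNgt kab.
Qed.

Theorem good_labeling_represents12 (V : {fset nat}) (e : rel nat) :
  symmetric e -> good_labeling V e -> exists w, represents12 w V e.
Proof.
move=> esym hV; pose s := sort (relpre fst leq) (occurrences V e).
have ss : sorted (relpre fst leq) s.
  by apply: sort_sorted => p q; apply: leq_total.
exists [seq p.2 | p <- s]; split=> [x|x y].
  apply/mapP/idP => [[[k z]]|xV].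
    by rewrite mem_sort => /mem_occurrences[zV _] ->.
  exists ((last_rank V e x).*2, x) => //.
  by rewrite mem_sort mem_cat; apply/orP; right; apply/mapP; exists x.
wlog: x y / x < y => [wl|xy] xV yV ne.
  have [ltxy|ltyx] : x < y \/ y < x by lia.
    exact: wl.
  by have := wl y x ltyx yV xV (nesym ne); rewrite minnC maxnC esym.
rewrite (minn_idPl (ltnW xy)) (maxn_idPr (ltnW xy)); split=> [/negP nexy|].
  apply: (@key_lt_occurs_before _ (first_rank V e x).*2.+1 _
    (last_rank V e y).*2) => //.
  - by rewrite mem_sort mem_cat; apply/orP; left; apply/mapP; exists x.
  - by rewrite mem_sort mem_cat; apply/orP; right; apply/mapP; exists y.
  have: first_rank V e x < last_rank V e y; last lia.
  apply: first_rank_lt_last_rank => //.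
  by rewrite /lower_nonedge /lower_edge xy ltnW.
move=> /(occurs_before_key_le ss)[kx [ky []]]; rewrite !mem_sort.
move=> /mem_occurrences[_ hx] /mem_occurrences[_ hy] kxy exy.
(* Otherwise [kx <= ky] would lie strictly above twice the first rank of [x] and at most at twice
   the last rank of [y]. *)
have: last_rank V e y <= first_rank V e x; last lia.
by apply: last_rank_le_first_rank; rewrite // /lower_edge xy.
Qed.

(** A decidable form of [label_edge], so that the case distinctions on edges are constructive. *)
Definition label_edgeb (G : {fset point}) (lab : point -> nat) : rel nat :=
  fun a b => has (fun u => has (fun v =>
    [&& grid_adj u v, lab u == a & lab v == b]) G) G.

Lemma label_edgeP (G : {fset point}) (lab : point -> nat) a b :
  reflect (label_edge G lab a b) (label_edgeb G lab a b).
Proof.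
apply: (iffP hasP) => [[u uG /hasP[v vG /and3P[uv /eqP ua /eqP vb]]]|].
  by exists u, v.
move=> [u [v [uG vG uv ua vb]]]; exists u => //; apply/hasP; exists v => //.
by rewrite uv ua vb !eqxx.
Qed.

Lemma grid_adjC : symmetric grid_adj.
Proof.
by move=> u v; rewrite /grid_adj -[(u.1 - v.1)%R]GRing.opprB
  -[(u.2 - v.2)%R]GRing.opprB !GRing.sqrrN.
Qed.

Lemma label_edgeb_sym (G : {fset point}) (lab : point -> nat) :
  symmetric (label_edgeb G lab).
Proof.
suff h a b : label_edge G lab a b -> label_edge G lab b a.
  by move=> a b; apply/label_edgeP/label_edgeP; apply: h.
by move=> [u [v [uG vG uv ua vb]]]; exists v, u; rewrite grid_adjC.
Qed.

Theorem theorem21 (G : {fset point}) (lab : point -> nat)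
    (hG : square_grid_graph G) (hlab : is_labeling G lab)
    (hgood : good_labeling (label_set G lab) (label_edge G lab)) :
  exists w : seq nat, represents12 w (label_set G lab) (label_edge G lab).
Proof.
have eE a b : label_edge G lab a b <-> label_edgeb G lab a b.
  by split=> /label_edgeP.
have [||w [wV wE]] :=
  @good_labeling_represents12 (label_set G lab) (label_edgeb G lab).
- exact: label_edgeb_sym.
- case: hgood => h1 h2 h3; split.
  + move=> p q r pV qV rV pqr []; rewrite -!eE => e1 e2 n1.
    exact: (h1 p q r).
  + move=> p q r s pV qV rV sV pqr rs [[+ +] []].
    by rewrite -!eE => e1 e2 n1 n2 n3 n4; apply: (h2 p q r s).
  + move=> p q r s pV qV rV sV pqr rs [[+ +] []].
    by rewrite -!eE => e1 e2 n1 n2 n3 n4; apply: (h3 p q r s).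
- by exists w; split=> // x y xV yV ne; rewrite eE; apply: wE.
Qed.
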